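(* A non-wasteful mechanism for online fair division is strategy-proof if and only if it is a memoryless step mechanism (i.e. it is both a memoryless mechanism and a step mechanism).
   Context: Setting. An online fair division instance consists of a set of agents $N=\{1,\ldots,n\}$, an ordered set of indivisible items $O=\{o_1,\ldots,o_m\}$, and sincere utilities $u_{ij}\in\mathbb{R}_{\ge 0}$ of each agent $i\in N$ for each item $o_j$. It is supposed that at least one agent has positive utility for every item (otherwise the item can simply be discarded). Item $o_j$ arrives at round $j$, and each agent $i$ places a possibly strategic bid $v_{ij}\in\mathbb{R}_{\ge 0}$ for it (bidding sincerely means $v_{ij}=u_{ij}$). An (online) mechanism allocates $o_j$ immediately and irrevocably (possibly with randomization), with the allocation of $o_1,\ldots,o_{j-1}$ fixed and with no information about $o_{j+1},\ldots,o_m$; thus its behaviour on $o_1,\ldots,o_j$ depends only on the bids for $o_1,\ldots,o_j$. An allocation $\pi_j$ of $o_1,\ldots,o_j$ gives a bundle $\pi_{ji}$ to each agent $i$, with the bundles pairwise disjoint and with union $\{o_1,\ldots,o_j\}$; $\Pi_j$ is the set of all such allocations, and a mechanism induces a probability distribution over $\Pi_j$. A mechanism is non-wasteful if it shares the probability of 1 for each $o_j$ only among agents that bid positively for it if there is at least one such agent and, otherwise, discards $o_j$. Write $p_{ih}(\Pi_j)$ for the probability that agent $i$ receives item $o_h$ in this distribution, $p_i(\Pi_j)=p_{ij}(\Pi_j)$, and $\overline{u}_i(\Pi_j)=\sum_{h=1}^{j}p_{ih}(\Pi_j)\,u_{ih}$ for the expected utility of agent $i$. Strategy-proof: for each instance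 with $m\in\mathbb{N}$ items, no agent $i\in N$ can strictly increase $\overline{u}_i(\Pi_m)$ by reporting any sequence $v_{i1},\ldots,v_{im}$ other than $u_{i1},\ldots,u_{im}$, supposing all other agents bid sincerely for $o_1,\ldots,o_m$. Step: $p_i(\Pi_j)$ is a step function if it is $0$ when $v_{ij}=0$ and it takes the same value for every bid $v_{ij}>0$, supposing the bids of the other agents for $o_1,\ldots,o_j$ and the bids of agent $i$ for $o_1,\ldots,o_{j-1}$ are fixed. A mechanism is a step mechanism if, for each instance with $m\in\mathbb{N}$ items, each $i\in N$ and each $o_j\in O$, $p_i(\Pi_j)$ is a step function. Memoryless: $p_i(\Pi_j)$ is a memoryless function if it takes the same value for all possible bids $v_{i1},\ldots,v_{i(j-1)}$ of agent $i$ for $o_1,\ldots,o_{j-1}$, given a fixed bid $v_{ij}$ of agent $i$ for $o_j$ and fixed bids of the other agents for $o_1,\ldots,o_j$. A mechanism is a memoryless mechanism if, for each instance with $m\in\mathbb{N}$ items, each $i\in N$ and each $o_j\in O$, $p_i(\Pi_j)$ is a memoryless function. *)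

(* Defs.v *)
From mathcomp Require Import all_boot all_order all_algebra.
From mathcomp Require Import reals.

Set Implicit Arguments.
Unset Strict Implicit.
Unset Printing Implicit Defensive.

Import Order.TTheory GRing.Theory Num.Theory.
Local Open Scope ring_scope.

(* Agents are 'I_n; the items of an m-item instance are 'I_m, in order of      *)
(* arrival. Utilities and bids are matrices 'M[R]_(n, m) with a row per agent. *)

Definition bid_profile (R : realType) (n m : nat) (b : 'M[R]_(n, m)) : Prop :=
  forall i j, 0 <= b i j.

Definition instance (R : realType) (n m : nat) (u : 'M[R]_(n, m)) : Prop :=
  bid_profile u /\ forall j, exists i, 0 < u i j.

(* The bundle of agent i is {h | a h = Some i}, so bundles are pairwise        *)
(* disjoint by construction. The value None records that an item is discarded; *)
(* the bundles cover all the items that are not discarded.                     *)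
Definition allocation (n m : nat) := {ffun 'I_m -> option 'I_n}.

(* Bids for the items up to and including item j. *)
Definition bids_upto (R : realType) (n m : nat) (b : 'M[R]_(n, m)) (j : 'I_m) :
    'M[R]_(n, j.+1) :=
  colsub (widen_ord (ltn_ord j)) b.

(* Allocation of the items strictly before item j. *)
Definition alloc_before (n m : nat) (a : allocation n m) (j : 'I_m) :
    allocation n j :=
  [ffun h => a (widen_ord (ltnW (ltn_ord j)) h)].

(* When an item arrives after j others, rule b a x is the probability that it  *)
(* goes to x (is discarded if x = None), given the bids b for all the items    *)
(* seen so far, including the current one, and the allocation a of the j       *)
(* previous items. The number of items still to come is not an argument.       *)
Record mechanism (R : realType) (n : nat) := Mechanism {
  rule : forall j : nat, 'M[R]_(n, j.+1) -> allocation n j -> option 'I_n -> R;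
  rule_ge0 : forall j (b : 'M[R]_(n, j.+1)) (a : allocation n j) x,
    0 <= rule b a x;
  rule_sum1 : forall j (b : 'M[R]_(n, j.+1)) (a : allocation n j),
    \sum_x rule b a x = 1
}.

(* The distribution over allocations of m items induced by the bids b. *)
Definition alloc_prob (R : realType) (n : nat) (M : mechanism R n) (m : nat)
    (b : 'M[R]_(n, m)) (a : allocation n m) : R :=
  \prod_(j < m) rule M (bids_upto b j) (alloc_before a j) (a j).

Definition item_prob (R : realType) (n : nat) (M : mechanism R n) (m : nat)
    (b : 'M[R]_(n, m)) (h : 'I_m) (x : option 'I_n) : R :=
  \sum_(a : allocation n m | a h == x) alloc_prob M b a.

(* p_i(Pi_j) = p_ij(Pi_j): the probability that i receives item j in the       *)
(* distribution over the allocations of the items up to j only.                *)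
Definition round_prob (R : realType) (n : nat) (M : mechanism R n) (m : nat)
    (b : 'M[R]_(n, m)) (j : 'I_m) (x : option 'I_n) : R :=
  item_prob M (bids_upto b j) ord_max x.

(* Expected utility of agent i with sincere utilities u when the bids are b. *)
Definition expected_utility (R : realType) (n : nat) (M : mechanism R n)
    (m : nat) (u b : 'M[R]_(n, m)) (i : 'I_n) : R :=
  \sum_(h < m) item_prob M b h (Some i) * u i h.

Definition non_wasteful (R : realType) (n : nat) (M : mechanism R n) : Prop :=
  forall (m : nat) (b : 'M[R]_(n, m)), bid_profile b -> forall j : 'I_m,
    ((exists i, 0 < b i j) ->
       \sum_(i | 0 < b i j) round_prob M b j (Some i) = 1) /\
    (~ (exists i, 0 < b i j) -> round_prob M b j None = 1).

Definition report (R : realType) (n m : nat) (u : 'M[R]_(n, m)) (i : 'I_n)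
    (v : 'rV[R]_m) : 'M[R]_(n, m) :=
  \matrix_(k, h) (if k == i then v 0 h else u k h).

Definition strategy_proof (R : realType) (n : nat) (M : mechanism R n) : Prop :=
  forall (m : nat) (u : 'M[R]_(n, m)), instance u ->
  forall (i : 'I_n) (v : 'rV[R]_m), (forall h, 0 <= v 0 h) ->
    ~ (expected_utility M u u i < expected_utility M u (report u i v) i).

Definition step_mechanism (R : realType) (n : nat) (M : mechanism R n) : Prop :=
  forall (m : nat) (i : 'I_n) (j : 'I_m) (b : 'M[R]_(n, m)), bid_profile b ->
    (b i j = 0 -> round_prob M b j (Some i) = 0) /\
    (forall b' : 'M[R]_(n, m), bid_profile b' ->
       (forall (k : 'I_n) (h : 'I_m), (h <= j)%N -> (k, h) != (i, j) ->
          b' k h = b k h) ->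
       0 < b i j -> 0 < b' i j ->
       round_prob M b' j (Some i) = round_prob M b j (Some i)).

Definition memoryless_mechanism (R : realType) (n : nat) (M : mechanism R n) :
    Prop :=
  forall (m : nat) (i : 'I_n) (j : 'I_m) (b b' : 'M[R]_(n, m)),
    bid_profile b -> bid_profile b' ->
    (forall (k : 'I_n) (h : 'I_m), (h <= j)%N -> k != i -> b' k h = b k h) ->
    b' i j = b i j ->
    round_prob M b' j (Some i) = round_prob M b j (Some i).

(* Main.v *)
Require Import Defs.
From mathcomp Require Import all_boot all_order all_algebra.
From mathcomp Require Import reals.
From mathcomp Require Import lra.

(** Strategy-proofness says nothing directly about bid profiles in which nobody
    wants some past item, because these are not sincere. On profiles without
    such items, induction on the round shows that the probability of agent i for
    the current item depends on i's bids only through their supports (deviate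
    between two profiles with equal supports), and then, scaling i's past
    utilities down to 0, that no change of i's bids increases it. A profile
    with unwanted past items is the member q(set0) of a family q(S) in which
    the agents of S bid 1 for all of these items. There, q(S) i does not depend
    on whether i is in S, as long as S contains some other agent, and
    q(set0) i <= q([set i]) i. As the q(S) i sum to 1 over i for every S, taking
    the sum over S with signs (-1)^#|S| shows that the last inequalities are
    equalities. *)

Set Implicit Arguments.
Unset Strict Implicit.
Unset Printing Implicit Defensive.

Import Order.TTheory GRing.Theory Num.Theory.
Local Open Scope ring_scope.

(** * Signed sums over sets *)

(** Adding [i] matches the sets without [i] with the sets containing it, and flips the sign. *)
Lemma sum_sign_set (R : pzRingType) (T : finType) (f : {set T} -> R) (i : T) :
  \sum_(S : {set T}) (-1) ^+ #|S| * f S =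
  \sum_(S : {set T} | i \notin S) (-1) ^+ #|S| * (f S - f (i |: S)).
Proof.
rewrite (bigID (fun S : {set T} => i \notin S)) /=.
rewrite [X in _ + X](reindex_onto (fun S => i |: S) (fun S => S :\ i)) /=; last first.
  by move=> S; rewrite negbK => iS; rewrite setD1K.
rewrite [X in _ + X](eq_bigl (fun S : {set T} => i \notin S)); last first.
  move=> S; rewrite setU11 /=; apply/eqP/idP => [<-|iS]; first by rewrite setD11.
  by rewrite setU1K.
rewrite -big_split /=; apply: eq_bigr => S iS.
by rewrite cardsU1 iS exprS mulN1r mulrBr mulNr.
Qed.

Lemma eq_set0_set1 (R : realDomainType) (T : finType) (q : {set T} -> T -> R) :
  (forall S, \sum_i q S i = 1) ->
  (forall i (S : {set T}), i \notin S -> S != set0 -> q (i |: S) i = q S i) ->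
  (forall i, q set0 i <= q [set i] i) ->
  forall i, q set0 i = q [set i] i.
Proof.
move=> q1 qU q_le i.
have : \sum_k (q [set k] k - q set0 k) = 0.
  have : \sum_(S : {set T}) (-1) ^+ #|S| * (\sum_k q S k) = 0.
    under eq_bigr => S _ do rewrite q1.
    (* Pairing along [i] cancels a constant function completely. *)
    rewrite (@sum_sign_set _ _ (fun=> 1) i) big1 // => S _.
    by rewrite subrr mulr0.
  under eq_bigr => S _ do rewrite mulr_sumr.
  rewrite exchange_big /= => q0; apply: oppr_inj; rewrite oppr0 -[RHS]q0.
  rewrite -sumrN; apply: eq_bigr => k _.
  rewrite (@sum_sign_set _ _ (fun S => q S k) k).
  (* By [qU], only the pair of [set0] and [[set k]] survives. What remains is a zero sum of terms of
     one sign. *)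
  rewrite (bigD1 set0) ?inE //= big1 ?addr0.
    by rewrite cards0 expr0 mul1r setU0 opprB.
  by move=> S /andP[kS S0]; rewrite qU // subrr mulr0.
move/eqP; rewrite psumr_eq0 => [/allP/(_ i)|k _]; last by rewrite subr_ge0.
by rewrite mem_index_enum subr_eq0 => /(_ isT) /eqP.
Qed.

(** * Prefixes of bids and marginals of the distribution over allocations *)

Lemma bids_upto_max (R : realType) (n m : nat) (b : 'M[R]_(n, m)) (j : 'I_m) k :
  bids_upto b j k ord_max = b k j.
Proof. by rewrite mxE; congr (b _ _); apply: val_inj. Qed.

Lemma bid_profile_upto (R : realType) (n m : nat) (b : 'M[R]_(n, m)) (j : 'I_m) :
  bid_profile b -> bid_profile (bids_upto b j).
Proof. by move=> b0 k h; rewrite mxE. Qed.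

Section Probabilities.
Variables (R : realType) (n : nat) (M : mechanism R n).

Definition alloc_init (m : nat) (a : allocation n m.+1) : allocation n m :=
  [ffun h => a (widen_ord (leqnSn m) h)].

Definition alloc_rcons (m : nat) (a : allocation n m) (x : option 'I_n) :
    allocation n m.+1 :=
  [ffun h => if unlift ord_max h is Some h' then a h' else x].

Definition bids_init (m : nat) (b : 'M[R]_(n, m.+1)) : 'M[R]_(n, m) :=
  colsub (widen_ord (leqnSn m)) b.

Lemma widen_lift (m : nat) (h : 'I_m) : widen_ord (leqnSn m) h = lift ord_max h.
Proof. by apply: val_inj; rewrite /= /bump leqNgt ltn_ord. Qed.

Lemma alloc_rcons_widen m (a : allocation n m) x h :
  alloc_rcons a x (widen_ord (leqnSn m) h) = a h.
Proof. by rewrite ffunE widen_lift liftK. Qed.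

Lemma alloc_rconsK m (a : allocation n m) x : alloc_init (alloc_rcons a x) = a.
Proof. by apply/ffunP => h; rewrite ffunE alloc_rcons_widen. Qed.

Lemma alloc_rcons_max m (a : allocation n m) x : alloc_rcons a x ord_max = x.
Proof. by rewrite ffunE unlift_none. Qed.

Lemma alloc_init_rcons m (a : allocation n m.+1) :
  alloc_rcons (alloc_init a) (a ord_max) = a.
Proof.
apply/ffunP => h; rewrite ffunE; case: unliftP => [h' ->|-> //].
by rewrite ffunE widen_lift.
Qed.

Lemma bids_upto_init m (b : 'M[R]_(n, m.+1)) (h : 'I_m) :
  bids_upto (bids_init b) h = bids_upto b (widen_ord (leqnSn m) h).
Proof. by apply/matrixP => k l; rewrite !mxE; congr (b _ _); apply: val_inj. Qed.

Lemma bids_upto_ord_max m (b : 'M[R]_(n, m.+1)) : bids_upto b ord_max = b.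
Proof. by apply/matrixP => k l; rewrite !mxE; congr (b _ _); apply: val_inj. Qed.

Lemma alloc_prob_rcons m (b : 'M[R]_(n, m.+1)) (a : allocation n m) x :
  alloc_prob M b (alloc_rcons a x) = alloc_prob M (bids_init b) a * rule M b a x.
Proof.
rewrite /alloc_prob big_ord_recr /=; congr (_ * _).
  apply: eq_bigr => h _; rewrite bids_upto_init alloc_rcons_widen.
  congr (rule M _ _ _); apply/ffunP => l; rewrite [LHS]ffunE [RHS]ffunE.
  by rewrite -[RHS](alloc_rcons_widen a x); congr (alloc_rcons a x _); apply: val_inj.
rewrite bids_upto_ord_max alloc_rcons_max; congr (rule M _ _ _).
apply/ffunP => l; rewrite ffunE -[RHS](alloc_rcons_widen a x).
by congr (alloc_rcons a x _); apply: val_inj.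
Qed.

(** The last item sums out because the probabilities given by its rule add up to 1. *)
Lemma sum_alloc_init m (b : 'M[R]_(n, m.+1)) (P : pred (allocation n m)) :
  \sum_(a | P (alloc_init a)) alloc_prob M b a =
  \sum_(a | P a) alloc_prob M (bids_init b) a.
Proof.
rewrite (reindex_onto (fun p : allocation n m * option 'I_n => alloc_rcons p.1 p.2)
  (fun a => (alloc_init a, a ord_max))) /=; last by move=> a _; rewrite alloc_init_rcons.
transitivity (\sum_(a | P a) \sum_x alloc_prob M b (alloc_rcons a x)).
  rewrite pair_big; apply: eq_bigl => -[a x] /=.
  by rewrite alloc_rconsK alloc_rcons_max eqxx !andbT.
apply: eq_bigr => a _; under eq_bigr => x _ do rewrite alloc_prob_rcons.
by rewrite -mulr_sumr rule_sum1 mulr1.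
Qed.

Lemma alloc_prob_sum1 m (b : 'M[R]_(n, m)) : \sum_a alloc_prob M b a = 1.
Proof.
elim: m b => [|m IHm] b; last by rewrite (sum_alloc_init b xpredT).
rewrite (eq_bigr (fun=> 1)) => [|a _]; last by rewrite /alloc_prob big_ord0.
by rewrite sumr_const card_ffun card_ord expn0.
Qed.

(** Later rounds never revise the fate of an item, so they sum out one by one. This links expected
    utilities to the round probabilities in the definitions of step and memoryless. *)
Lemma item_prob_round m (b : 'M[R]_(n, m)) (h : 'I_m) x :
  item_prob M b h x = round_prob M b h x.
Proof.
elim: m b h => [|m IHm] b h; first by case: h.
case: (unliftP ord_max h) => [h' ->|->].
  rewrite -widen_lift; transitivity (round_prob M (bids_init b) h' x); last first.
    by rewrite /round_prob bids_upto_init.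
  rewrite -IHm [RHS]/item_prob -(sum_alloc_init b (fun a => a h' == x)).
  by apply: eq_bigl => a; rewrite ffunE.
rewrite /round_prob bids_upto_ord_max; congr (item_prob M b _ x).
Qed.

Lemma item_prob_ge0 m (b : 'M[R]_(n, m)) h x : 0 <= item_prob M b h x.
Proof. by apply: sumr_ge0 => a _; apply: prodr_ge0 => j _; apply: rule_ge0. Qed.

Lemma item_prob_sum1 m (b : 'M[R]_(n, m)) h :
  item_prob M b h None + \sum_i item_prob M b h (Some i) = 1.
Proof.
rewrite -[RHS](alloc_prob_sum1 b).
rewrite (partition_big (fun a : allocation n m => a h) xpredT) //= (bigD1 None) //=.
congr (_ + _); rewrite (reindex_omap Some id) /=; last by case.
by apply: eq_bigl => i; rewrite eqxx.
Qed.

Lemma item_prob_le1 m (b : 'M[R]_(n, m)) h i : item_prob M b h (Some i) <= 1.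
Proof.
rewrite -(item_prob_sum1 b h) (bigD1 i) //= addrCA lerDl addr_ge0 ?item_prob_ge0 //.
by apply: sumr_ge0 => k _; apply: item_prob_ge0.
Qed.

Hypothesis nwM : non_wasteful M.

(** The positive bidders, or else the discarding of the item, already take up the whole probability
    1. *)
Lemma item_prob_zero_bid m (b : 'M[R]_(n, m)) h i :
  bid_profile b -> b i h = 0 -> item_prob M b h (Some i) = 0.
Proof.
move=> b0 bi0; have [nw_pos nw_none] := nwM b0 h.
have := item_prob_sum1 b h; have i_ge0 := item_prob_ge0 b h (Some i).
have None_ge0 := item_prob_ge0 b h None.
have [/existsP pos|/existsP none] := boolP [exists k, 0 < b k h].
  have := nw_pos pos; under eq_bigr do rewrite -item_prob_round.
  move=> pos1; rewrite (bigID (fun k => 0 < b k h)) /= pos1 (bigD1 i) /= ?bi0 ?ltxx //.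
  have : 0 <= \sum_(k | ~~ (0 < b k h) && (k != i)) item_prob M b h (Some k).
    by apply: sumr_ge0 => k _; apply: item_prob_ge0.
  by lra.
have := nw_none none; rewrite -item_prob_round => ->; rewrite (bigD1 i) //=.
have : 0 <= \sum_(k | k != i) item_prob M b h (Some k).
  by apply: sumr_ge0 => k _; apply: item_prob_ge0.
by lra.
Qed.

Lemma item_prob_sum_agents m (b : 'M[R]_(n, m)) h i :
  bid_profile b -> 0 < b i h -> \sum_k item_prob M b h (Some k) = 1.
Proof.
move=> b0 bi; have [/(_ (ex_intro _ i bi)) <- _] := nwM b0 h.
rewrite [RHS]big_mkcond; apply: eq_bigr => k _; rewrite -item_prob_round.
by case: ifPn => //; rewrite lt0r b0 andbT negbK => /eqP/item_prob_zero_bid ->.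
Qed.

End Probabilities.

(** * Insensitivity of an agent's chances to their own bids *)

Section StrategyProof.
Variables (R : realType) (n : nat) (M : mechanism R n).
Hypothesis nwM : non_wasteful M.

Definition agree_off (m : nat) (i : 'I_n) (b b' : 'M[R]_(n, m)) : Prop :=
  forall k h, k != i -> b' k h = b k h.

Lemma agree_off_sym m i (b b' : 'M[R]_(n, m)) : agree_off i b b' -> agree_off i b' b.
Proof. by move=> bb' k h ki; rewrite bb'. Qed.

Lemma agree_off_trans m i (b1 b2 b3 : 'M[R]_(n, m)) :
  agree_off i b1 b2 -> agree_off i b2 b3 -> agree_off i b1 b3.
Proof. by move=> b12 b23 k h ki; rewrite b23 ?b12. Qed.

Lemma report_agree_off m i (b b' : 'M[R]_(n, m)) :
  agree_off i b b' -> report b i (row i b') = b'.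
Proof. by move=> bb'; apply/matrixP => k h; rewrite !mxE; case: eqVneq => [->|/bb' ->]. Qed.

(** Memoryless and step merged into one condition on the last of [j.+1] items: the past bids of [i]
    may change arbitrarily and the current one among positive values. Zero current bids are settled
    by non-wastefulness. *)
Definition insensitive (j : nat) : Prop :=
  forall (i : 'I_n) (b b' : 'M[R]_(n, j.+1)),
    bid_profile b -> bid_profile b' -> agree_off i b b' ->
    0 < b i ord_max -> 0 < b' i ord_max ->
    item_prob M b' ord_max (Some i) = item_prob M b ord_max (Some i).

Lemma insensitive_item_prob m (j : 'I_m) (i : 'I_n) (b b' : 'M[R]_(n, m)) :
  insensitive j -> bid_profile b -> bid_profile b' ->
  (forall (k : 'I_n) (h : 'I_m), (h <= j)%N -> k != i -> b' k h = b k h) ->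
  0 < b i j -> 0 < b' i j ->
  item_prob M b' j (Some i) = item_prob M b j (Some i).
Proof.
move=> ins b0 b'0 bb' bi b'i; rewrite !item_prob_round.
apply: ins; rewrite ?bids_upto_max //; try exact: bid_profile_upto.
by move=> k h ki; rewrite !mxE bb' //= -ltnS.
Qed.

Lemma insensitive_memoryless_step : (forall j, insensitive j) ->
  memoryless_mechanism M /\ step_mechanism M.
Proof.
move=> ins; split=> [m i j b b' b0 b'0 bb' eq_ij|m i j b b0].
  rewrite -!item_prob_round.
  have [bij|] := eqVneq (b i j) 0; first by rewrite !item_prob_zero_bid ?eq_ij.
  move=> bij; have {}bij : 0 < b i j by rewrite lt0r bij b0.
  by apply: insensitive_item_prob => //; rewrite eq_ij.
rewrite -!item_prob_round; split=> [|b' b'0 bb' bij b'ij].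
  exact: item_prob_zero_bid.
rewrite -item_prob_round; apply: insensitive_item_prob => // k h hj ki.
by apply: bb' => //; rewrite xpair_eqE (negbTE ki).
Qed.

Lemma memoryless_step_insensitive :
  memoryless_mechanism M -> step_mechanism M -> forall j, insensitive j.
Proof.
move=> mem stp j i b b' b0 b'0 bb' bi b'i; rewrite !item_prob_round.
(* An intermediate profile: from [b] to [c] only the current bid of [i] changes (step), from [c] to
   [b'] only the past bids of [i] (memoryless). *)
pose c : 'M[R]_(n, j.+1) := \matrix_(k, h)
  if (k, h) == (i, ord_max) then b' k h else b k h.
have c0 : bid_profile c by move=> k h; rewrite mxE; case: ifP.
have ci : c i ord_max = b' i ord_max by rewrite mxE eqxx.
transitivity (round_prob M c ord_max (Some i)).
  apply: mem => // k h _ ki.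
  by rewrite mxE xpair_eqE (negbTE ki) bb'.
have [_ ] := stp _ i ord_max b b0; apply=> //; last by rewrite ci.
by move=> k h _ /negbTE kh; rewrite mxE kh.
Qed.

(** The comparison holds item by item: an item of utility 0 does not count, a zero bid wins nothing,
    and any other bid leaves the probability unchanged. *)
Lemma insensitive_strategy_proof : (forall j, insensitive j) -> strategy_proof M.
Proof.
move=> ins m u [u0 _] i v v0; apply/negP; rewrite -leNgt; apply: ler_sum => h _.
have r0 : bid_profile (report u i v) by move=> k l; rewrite mxE; case: ifP.
have rE : report u i v i h = v 0 h by rewrite mxE eqxx.
have [uih|uih] := eqVneq (u i h) 0; first by rewrite uih !mulr0.
apply: ler_wpM2r => //; have [vh|vh] := eqVneq (v 0 h) 0.
  by rewrite [leLHS]item_prob_zero_bid ?rE ?item_prob_ge0.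
rewrite (@insensitive_item_prob _ h i u) ?lt0r ?rE ?uih ?vh ?u0 ?v0 //.
by move=> k l _ /negbTE ki; rewrite mxE ki.
Qed.

(** * Consequences of strategy-proofness on sincere profiles *)

Hypothesis spM : strategy_proof M.

Lemma strategy_proof_agree_off j (i : 'I_n) (b b' : 'M[R]_(n, j.+1)) :
  instance b -> bid_profile b' -> agree_off i b b' ->
  \sum_(h < j) item_prob M b' (widen_ord (leqnSn j) h) (Some i)
      * b i (widen_ord (leqnSn j) h)
    + item_prob M b' ord_max (Some i) * b i ord_max <=
  \sum_(h < j) item_prob M b (widen_ord (leqnSn j) h) (Some i)
      * b i (widen_ord (leqnSn j) h)
    + item_prob M b ord_max (Some i) * b i ord_max.
Proof.
move=> bI b'0 bb'; have v0 h : 0 <= row i b' 0 h by rewrite mxE.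
have := spM bI v0 (i := i); rewrite report_agree_off // => /negP.
by rewrite -leNgt /expected_utility !big_ord_recr.
Qed.

Section Round.
Variable j : nat.
Hypothesis IHj : forall h, (h < j)%N -> insensitive h.

(** Past items that [i] values keep their probabilities by [IHj], and the others have weight 0. The
    past contributions cancel, so strategy-proofness compares the last item alone. *)
Lemma item_prob_le_support (i : 'I_n) (b b' : 'M[R]_(n, j.+1)) :
  instance b -> bid_profile b' -> agree_off i b b' -> 0 < b i ord_max ->
  (forall h, 0 < b i h -> 0 < b' i h) ->
  item_prob M b' ord_max (Some i) <= item_prob M b ord_max (Some i).
Proof.
move=> bI b'0 bb' bi supp; have b0 := bI.1.
have := strategy_proof_agree_off bI b'0 bb'.
rewrite (eq_bigr (fun h => item_prob M b (widen_ord (leqnSn j) h) (Some i)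
      * b i (widen_ord (leqnSn j) h))); last first.
  move=> h _; set h' := widen_ord _ h.
  have [-> |bih] := eqVneq (b i h') 0; first by rewrite !mulr0.
  have {}bih : 0 < b i h' by rewrite lt0r bih b0.
  congr (_ * _); apply: insensitive_item_prob => //; last exact: supp.
    exact: IHj (ltn_ord h).
  by move=> k l _; apply: bb'.
by rewrite lerD2l ler_pM2r.
Qed.

Lemma item_prob_le_instance (i : 'I_n) (b b' : 'M[R]_(n, j.+1)) :
  instance b -> bid_profile b' -> agree_off i b b' -> 0 < b i ord_max ->
  item_prob M b' ord_max (Some i) <= item_prob M b ord_max (Some i).
Proof.
move=> bI b'0 bb' bi; have [b0 b_ex] := bI.
pose C := \sum_(h < j) b i (widen_ord (leqnSn j) h).
have C0 : 0 <= C by apply: sumr_ge0.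
rewrite -(ler_pM2r bi); apply/ler_addgt0Pr => e e0.
(* The scale that brings the past utility of [i] below [e]; the added 1 covers the case [C = 0]. *)
pose d := e / (C + 1).
have d0 : 0 < d by rewrite divr_gt0 // ltr_wpDl.
have dC : d * C <= e by rewrite /d mulrAC ler_pdivrMr ?ltr_wpDl //; nra.
pose c : 'M[R]_(n, j.+1) := \matrix_(k, h)
  if (k == i) && (h != ord_max) then d * b k h else b k h.
have c_gt0 k h : (0 < c k h) = (0 < b k h).
  by rewrite mxE; case: ifP => //; rewrite pmulr_rgt0.
have c0 : bid_profile c by move=> k h; rewrite mxE; case: ifP => // _; rewrite mulr_ge0 // ltW.
have cI : instance c by split=> // h; have [k bk] := b_ex h; exists k; rewrite c_gt0.
have bc : agree_off i b c by move=> k h /negbTE ki; rewrite mxE ki.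
have ci : c i ord_max = b i ord_max by rewrite mxE !eqxx.
have cd h : c i (widen_ord (leqnSn j) h) = d * b i (widen_ord (leqnSn j) h).
  by rewrite mxE eqxx widen_lift eq_sym neq_lift.
(* Scaling by [d > 0] preserves supports, so the previous lemma applies in both directions. *)
have cb_eq : item_prob M c ord_max (Some i) = item_prob M b ord_max (Some i).
  apply/le_anti/andP; split; apply: item_prob_le_support => //.
  - by move=> h; rewrite c_gt0.
  - exact: agree_off_sym.
  - by rewrite ci.
  - by move=> h; rewrite c_gt0.
(* Here [c] holds the sincere utilities and [b'] the deviation; past items can account for a loss of
   at most [e]. *)
have := strategy_proof_agree_off cI b'0 (agree_off_trans (agree_off_sym bc) bb').
rewrite cb_eq ci => sp_le.
have past_ge0 : 0 <= \sum_(h < j) item_prob M b' (widen_ord (leqnSn j) h) (Some i)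
    * c i (widen_ord (leqnSn j) h).
  by apply: sumr_ge0 => h _; rewrite mulr_ge0 ?item_prob_ge0.
have past_le : \sum_(h < j) item_prob M c (widen_ord (leqnSn j) h) (Some i)
    * c i (widen_ord (leqnSn j) h) <= d * C.
  rewrite mulr_sumr; apply: ler_sum => h _; rewrite -cd.
  by rewrite ler_piMl ?item_prob_le1.
lra.
Qed.

Lemma item_prob_eq_instance (i : 'I_n) (b b' : 'M[R]_(n, j.+1)) :
  instance b -> instance b' -> agree_off i b b' ->
  0 < b i ord_max -> 0 < b' i ord_max ->
  item_prob M b' ord_max (Some i) = item_prob M b ord_max (Some i).
Proof.
move=> bI b'I bb' bi b'i; apply/le_anti/andP.
split; apply: item_prob_le_instance => //; [exact: b'I.1|exact: bI.1|].
exact: agree_off_sym.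
Qed.

(** * Profiles with items that nobody wants *)

Definition fill_unwanted (b : 'M[R]_(n, j.+1)) (S : {set 'I_n}) : 'M[R]_(n, j.+1) :=
  \matrix_(k, h) if [forall l, b l h == 0] then (k \in S)%:R else b k h.

Lemma fill_unwanted0 b : fill_unwanted b set0 = b.
Proof.
apply/matrixP => k h; rewrite mxE inE.
by case: ifP => // /forallP/(_ k)/eqP ->.
Qed.

Lemma fill_unwanted_profile b S : bid_profile b -> bid_profile (fill_unwanted b S).
Proof. by move=> b0 k h; rewrite mxE; case: ifP. Qed.

Lemma fill_unwanted_instance b S :
  bid_profile b -> S != set0 -> instance (fill_unwanted b S).
Proof.
move=> b0 /set0Pn[k kS]; split=> [|h]; first exact: fill_unwanted_profile.
have [dead|] := boolP [forall l, b l h == 0]; first by exists k; rewrite mxE dead kS.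
move=> dead; move: (dead); rewrite negb_forall => /existsP[l bl]; exists l.
by rewrite mxE (negbTE dead) lt0r bl b0.
Qed.

Lemma fill_unwanted_agree_off b i (S S' : {set 'I_n}) :
  (forall k, k != i -> (k \in S') = (k \in S)) ->
  agree_off i (fill_unwanted b S) (fill_unwanted b S').
Proof. by move=> SS' k h ki; rewrite !mxE SS'. Qed.

Lemma fill_unwanted_wanted (b : 'M[R]_(n, j.+1)) S h i k : 0 < b i h -> fill_unwanted b S k h = b k h.
Proof. by move=> bi; rewrite mxE ifF //; apply/forallP => /(_ i); rewrite gt_eqF. Qed.

(** The current item is wanted by [i], so filling leaves its bids alone and every [q S] sums to 1.
    For nonempty [S] the filled profiles are instances, which gives equalities; [b] itself may not
    be one, so passing from [set0] to [[set k]] gives only an inequality, which [eq_set0_set1]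
    sharpens. *)
Lemma item_prob_fill_unwanted b i : bid_profile b -> 0 < b i ord_max ->
  item_prob M b ord_max (Some i) =
  item_prob M (fill_unwanted b [set i]) ord_max (Some i).
Proof.
move=> b0 bi; rewrite -[in LHS](fill_unwanted0 b).
pose q S k := item_prob M (fill_unwanted b S) ord_max (Some k).
apply: (@eq_set0_set1 _ _ q) => [S|k S kS S0|k]; rewrite /q.
- by apply: (@item_prob_sum_agents _ _ _ nwM _ _ _ i);
    [exact: fill_unwanted_profile|rewrite (fill_unwanted_wanted _ _ bi)].
- have SkS l : l != k -> (l \in k |: S) = (l \in S) by rewrite !inE => /negbTE ->.
  have [bk|bk] := eqVneq (b k ord_max) 0.
    by rewrite !item_prob_zero_bid ?(fill_unwanted_wanted _ _ bi) //;
      apply: fill_unwanted_profile.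
  have {}bk : 0 < b k ord_max by rewrite lt0r bk b0.
  apply: item_prob_eq_instance; rewrite ?(fill_unwanted_wanted _ _ bi) //.
  + exact: fill_unwanted_instance.
  + by apply: fill_unwanted_instance => //; apply/set0Pn; exists k; rewrite setU11.
  + exact: fill_unwanted_agree_off.
- have [bk|bk] := eqVneq (b k ord_max) 0.
    by rewrite !item_prob_zero_bid ?(fill_unwanted_wanted _ _ bi) //;
      apply: fill_unwanted_profile.
  have {}bk : 0 < b k ord_max by rewrite lt0r bk b0.
  apply: item_prob_le_instance; rewrite ?(fill_unwanted_wanted _ _ bi) //.
  + by apply: fill_unwanted_instance => //; apply/set0Pn; exists k; rewrite set11.
  + exact: fill_unwanted_profile.
  + by apply: fill_unwanted_agree_off => l /negbTE lk; rewrite !inE lk.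
Qed.

(** Filling with [[set i]] turns both profiles into instances and changes only the row of [i], even
    if their unwanted items differ. The case of instances then applies. *)
Lemma insensitive_round : insensitive j.
Proof.
move=> i b b' b0 b'0 bb' bi b'i.
rewrite (item_prob_fill_unwanted b0 bi) (item_prob_fill_unwanted b'0 b'i).
have fill_off (c : 'M[R]_(n, j.+1)) : agree_off i c (fill_unwanted c [set i]).
  rewrite -{1}(fill_unwanted0 c); apply: fill_unwanted_agree_off => k /negbTE ki.
  by rewrite !inE ki.
have i_neq0 : [set i] != set0 by apply/set0Pn; exists i; rewrite set11.
apply: item_prob_eq_instance.
- exact: fill_unwanted_instance.
- exact: fill_unwanted_instance.
- apply: agree_off_trans (agree_off_sym (fill_off b)) _.
  exact: agree_off_trans bb' (fill_off b').
- by rewrite (fill_unwanted_wanted _ _ bi).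
- by rewrite (fill_unwanted_wanted _ _ b'i).
Qed.

End Round.

Lemma strategy_proof_insensitive j : insensitive j.
Proof. by elim/ltn_ind: j => j IHj; apply: insensitive_round. Qed.

End StrategyProof.

Theorem theorem1 (R : realType) (n : nat) (M : mechanism R n) :
  non_wasteful M ->
  (strategy_proof M <-> memoryless_mechanism M /\ step_mechanism M).
Proof.
move=> nwM; split=> [spM|[mem stp]].
  exact/insensitive_memoryless_step/strategy_proof_insensitive.
exact/insensitive_strategy_proof/memoryless_step_insensitive.
Qed.
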